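(* The family $\{g_{2n}: n\in\mathbb{Z},\ n\ge 0\}$ is an orthonormal basis of the Hilbert space $L^2(\mathcal{Z},\mathcal{M},\mu)$.
   Context: $\mathcal{Z}=[\frac14,+\infty)$; $\mathcal{M}$ is the $\sigma$-field of all Lebesgue measurable subsets of $\mathcal{Z}$; $\mu$ is the measure on $(\mathcal{Z},\mathcal{M})$ given by $\mu(E)=\int_E\frac{\sqrt{4z-1}}{2\pi z^2}\,dz$. $L^2(\mathcal{Z},\mathcal{M},\mu)$ is the space of real-valued $\mu$-measurable functions $f$ on $\mathcal{Z}$ (identified when equal $\mu$-a.e.) with $\int_{\mathcal{Z}}|f|^2\,d\mu<\infty$, with inner product $(f,g)=\int_{\mathcal{Z}}fg\,d\mu$. An orthonormal basis is a maximal orthonormal set. For each integer $n\ge0$, $g_{2n}(z)=\sum_{k=0}^{n}(-1)^k\binom{2n-k}{k}z^{k-n}$. *)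

(* Defs.v *)
From HB Require Import structures.
From mathcomp Require Import all_boot all_order all_algebra.
From mathcomp Require Import all_classical all_reals all_analysis.
From mathcomp Require Import measurable_realfun ring.

Set Implicit Arguments.
Unset Strict Implicit.
Unset Printing Implicit Defensive.

Import Order.TTheory GRing.Theory Num.Theory.
Import numFieldNormedType.Exports.

Local Open Scope classical_set_scope.
Local Open Scope ring_scope.

Definition Zset (R : realType) : set R := [set` `[4^-1, +oo[ ].

Definition Zspace (R : realType) : Type := set_type (@Zset R).

(* The domain sigma-algebra of [completed_lebesgue_measure]: the
   Caratheodory-measurable sets of the Lebesgue outer measure on R. *)
Definition lebesgue_measurable (R : realType) : set (set R) :=
  (@wlength R idfun)^*%mu.-cara.-measurable.

Definition Zmeasurable (R : realType) : set (set (Zspace R)) :=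
  [set E | lebesgue_measurable ((val : Zspace R -> R) @` E)].

Section Zspace_measurable.
Variable R : realType.

Lemma Zset_min : (4^-1 : R) \in @Zset R.
Proof. by rewrite inE /Zset /= in_itv/= lexx. Qed.

HB.instance Definition _ := Choice.on (Zspace R).
HB.instance Definition _ := isPointed.Build (Zspace R) (exist _ 4^-1 Zset_min).

Lemma borel_lebesgue_measurable (A : set R) :
  measurable A -> lebesgue_measurable A.
Proof. exact: (@sub_caratheodory _ _ _ (@wlength R idfun)). Qed.

Lemma Zset_lebesgue_measurable : lebesgue_measurable (@Zset R).
Proof. by apply: borel_lebesgue_measurable; exact: measurable_itv. Qed.

Lemma Zmeasurable0 : Zmeasurable (set0 : set (Zspace R)).
Proof. by rewrite /Zmeasurable /= image_set0; exact: measurable0. Qed.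

Lemma ZmeasurableC (A : set (Zspace R)) : Zmeasurable A -> Zmeasurable (~` A).
Proof.
rewrite /Zmeasurable /= => mA.
rewrite (_ : _ @` _ = @Zset R `\` (val : Zspace R -> R) @` A).
  exact: (measurableD Zset_lebesgue_measurable mA).
apply/seteqP; split => [_ [z nAz <-]|x [Zx nAx]].
  split; first exact: set_mem (valP z).
  by move=> [y Ay] /val_inj yz; apply: nAz; rewrite -yz.
exists (exist _ x (mem_set Zx)) => // Az.
by apply: nAx; eexists; first exact: Az.
Qed.

Lemma Zmeasurable_bigcup (F : (set (Zspace R))^nat) :
  (forall i, Zmeasurable (F i)) -> Zmeasurable (\bigcup_i F i).
Proof.
move=> mF; rewrite /Zmeasurable /= image_bigcup.
exact: bigcupT_measurable.
Qed.

HB.instance Definition _ := isMeasurable.Build default_measure_display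
  (Zspace R) Zmeasurable0 ZmeasurableC Zmeasurable_bigcup.

End Zspace_measurable.

Definition Zdensity (R : realType) (z : R) : R :=
  Num.sqrt (4 * z - 1) / (2 * pi * z ^+ 2).

Definition Zmu (R : realType) (E : set (Zspace R)) : \bar R :=
  (\int[@completed_lebesgue_measure R]_(z in (val : Zspace R -> R) @` E)
     (Zdensity z)%:E)%E.

Section Zmu_measure.
Variable R : realType.
Local Notation lebesgueT := (caratheodory_type (@wlength R idfun)^*%mu).
Local Notation vimage E := ((val : Zspace R -> R) @` E).

Lemma Zset_ge (z : R) : Zset z -> 4^-1 <= z.
Proof. by rewrite /Zset /= in_itv/= andbT. Qed.

Lemma Zset_gt0 (z : R) : Zset z -> 0 < z.
Proof. by move=> /Zset_ge; apply: lt_le_trans; rewrite invr_gt0. Qed.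

Lemma vimage_Zset (E : set (Zspace R)) : vimage E `<=` @Zset R.
Proof. by move=> _ [z _ <-]; exact: set_mem (valP z). Qed.

Lemma Zdensity_ge0 (z : R) : 0 <= Zdensity z.
Proof.
by rewrite divr_ge0 ?sqrtr_ge0// mulr_ge0 ?sqr_ge0// mulr_ge0// pi_ge0.
Qed.

Lemma borel_lebesgue_measurable_fun (D : set R) d (T : measurableType d)
    (f : R -> T) : measurable D -> measurable_fun D f ->
  @measurable_fun _ _ lebesgueT T D f.
Proof.
move=> mD mf _ Y mY; apply: borel_lebesgue_measurable; exact: mf.
Qed.

Lemma continuous_Zdensity (z : R) : 0 < z -> {for z, continuous (@Zdensity R)}.
Proof.
move=> z0; rewrite /Zdensity.
apply: cvgM.
  apply: (@continuous_comp _ _ _ (fun z : R => 4 * z - 1) Num.sqrt).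
    by apply: cvgB; [apply: cvgM; [exact: cvg_cst|exact: cvg_id]|exact: cvg_cst].
  exact: sqrt_continuous.
apply: cvgV; first by rewrite !mulf_neq0// ?gt_eqF// ?pi_gt0// exprn_gt0.
by apply: cvgM; [exact: cvg_cst|exact: exprn_continuous].
Qed.

Lemma measurable_Zdensity : measurable_fun (@Zset R) (@Zdensity R).
Proof.
apply: subspace_continuous_measurable_fun; first exact: measurable_itv.
apply: continuous_in_subspaceT => z; rewrite inE => Zz.
exact/continuous_Zdensity/Zset_gt0.
Qed.

Let mZdensity (E : set (Zspace R)) : measurable E ->
  @measurable_fun _ _ lebesgueT _ (vimage E) (EFin \o @Zdensity R).
Proof.
move=> mE; apply/measurable_EFinP.
apply: (@measurable_funS _ _ lebesgueT _ _ _ _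
  (@Zset_lebesgue_measurable R) (@vimage_Zset E)).
apply: borel_lebesgue_measurable_fun; first exact: measurable_itv.
exact: measurable_Zdensity.
Qed.

Let Zmu0 : Zmu (set0 : set (Zspace R)) = 0%E.
Proof. by rewrite /Zmu image_set0 integral_set0. Qed.

Let Zmu_ge0 (E : set (Zspace R)) : (0 <= Zmu E)%E.
Proof. by apply: integral_ge0 => z _; rewrite lee_fin Zdensity_ge0. Qed.

Let Zmu_semi_sigma_additive : semi_sigma_additive (@Zmu R).
Proof.
move=> F mF tF mUF; rewrite /Zmu image_bigcup.
rewrite ge0_integral_bigcup//=.
- apply: is_cvg_ereal_nneg_natsum => n _; exact: Zmu_ge0.
- by rewrite -image_bigcup; exact: mZdensity.
- by move=> z _; rewrite lee_fin Zdensity_ge0.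
- apply/trivIsetP => i j _ _ ij; rewrite -subset0 => z/= [[x Fx <-]] [y Fy].
  move=> /val_inj yx; move/trivIsetP : tF => /(_ i j I I ij).
  by rewrite -subset0; apply; split; [exact: Fx|rewrite -yx].
Qed.

HB.instance Definition _ := isMeasure.Build _ _ _ (@Zmu R)
  Zmu0 Zmu_ge0 Zmu_semi_sigma_additive.

End Zmu_measure.

Section L2_space.
Context d (T : measurableType d) (R : realType) (mu : {measure set T -> \bar R}).

(* Elements of [LspaceType2 mu] are classes modulo mu-a.e. equality (see
   [L2_eqP]), and [f x] evaluates a chosen representative of [f]; the integral
   does not depend on that choice. *)
Definition L2_dot (f g : LspaceType2 mu) : R := \int[mu]_x (f x * g x).

Lemma L2_eqP (f g : LspaceType2 mu) :
  f = g <-> ae_eq mu setT (f : T -> R) (g : T -> R).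
Proof.
split=> [->|fg]; first exact: ae_eq_refl.
have /eqP := introT (ae_eqP (LebesgueSpace.sort f) (LebesgueSpace.sort g)) fg.
rewrite !reprK => {}fg.
case: f g fg => [f [[cf]]] [g [[cg]]] /= fg.
by move: cg; rewrite -fg => cg; rewrite (Prop_irrelevance cf cg).
Qed.

Definition orthonormal (S : set (LspaceType2 mu)) : Prop :=
  (forall f, S f -> L2_dot f f = 1) /\
  (forall f g, S f -> S g -> f <> g -> L2_dot f g = 0).

Definition orthonormal_basis (S : set (LspaceType2 mu)) : Prop :=
  orthonormal S /\ forall S', orthonormal S' -> S `<=` S' -> S' = S.

Lemma measurable_sqr (h : T -> R) : measurable_fun setT h ->
  measurable_fun setT (fun x => (`|(EFin \o h) x| `^ 2)%E).
Proof.
move=> mh; rewrite (_ : (fun x => _) = EFin \o (fun x => `|h x| `^ 2)%R)//.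
apply/measurable_EFinP; apply: (measurableT_comp (measurable_powR _)).
exact: measurableT_comp.
Qed.

Lemma bounded_finite_norm (h : T -> R) (B : R) : (mu setT < +oo)%E ->
  measurable_fun setT h -> (forall x, `|h x| <= B) ->
  finite_norm mu 2%:E h.
Proof.
move=> mufin mh hB; rewrite /finite_norm unlock poweR_lty//.
apply: (@le_lt_trans _ _ (\int[mu]_x (B ^+ 2)%:E)%E); last first.
  by rewrite integral_cst// lte_mul_pinfty ?lee_fin ?sqr_ge0.
apply: ge0_le_integral => //.
- by move=> x _; exact: poweR_ge0.
- exact: measurable_sqr.
- move=> x _ /=; rewrite lee_fin powR_mulrn// lerXn2r ?nnegrE//.
  exact: le_trans (hB x).
Qed.

Section ae_class_of_Lfun.
Variable f : LfunType mu (lee1n 2).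

Lemma Lfun_measurableTypeR : @measurable_fun _ _ T (measurableTypeR R) setT f.
Proof. exact: (@measurable_funPT _ _ T R f). Qed.

Definition mfun_of_Lfun : {mfun T >-> measurableTypeR R} :=
  @mfun_Sub _ _ T (measurableTypeR R) f (mem_set Lfun_measurableTypeR).

Definition ae_class : {mfun_ mu, T >-> measurableTypeR R} :=
  (\pi mfun_of_Lfun)%qT.

Lemma ae_class_eq : ae_eq mu setT (ae_class : T -> R) f.
Proof.
have /eqmodP /asboolP : (repr ae_class = mfun_of_Lfun
  %[mod aeEqMfun (measurableTypeR R) mu])%qT by rewrite reprK.
by [].
Qed.

Lemma ae_class_finite_norm : finite_norm mu 2%:E (ae_class : T -> R).
Proof.
have := Lfunction_finite _ f; rewrite /finite_norm unlock.
suff -> : (\int[mu]_x (`|(EFin \o (ae_class : T -> R)) x| `^ 2) =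
           \int[mu]_x (`|(EFin \o f) x| `^ 2))%E by [].
apply: ge0_ae_eq_integral => //.
- apply: measurable_sqr.
  exact: (@measurable_funPT _ _ T (measurableTypeR R) (repr ae_class)).
- exact: measurable_sqr.
- by move=> x _; exact: poweR_ge0.
- by move=> x _; exact: poweR_ge0.
- by apply: filterS ae_class_eq => x /= fx _; rewrite fx.
Qed.

HB.instance Definition _ :=
  isFinLebesgue.Build d T R mu _ (lee1n 2) ae_class ae_class_finite_norm.

Definition L2_class : LspaceType2 mu := ae_class.

End ae_class_of_Lfun.

End L2_space.

(* [g_even n] is the function g_{2n}; the exponent [k - n] is an integer. *)
Definition g_even (R : realType) (n : nat) (z : Zspace R) : R :=
  \sum_(k < n.+1) (-1) ^+ k * 'C(2 * n - k, k)%:R * val z ^ (k%:Z - n%:Z).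

Section g_even_L2.
Variable R : realType.
Local Notation lebesgueT := (caratheodory_type (@wlength R idfun)^*%mu).

Lemma measurable_val : measurable_fun setT (val : Zspace R -> R).
Proof.
move=> _ Y mY; rewrite setTI.
rewrite [X in X _](_ : _ = @Zmeasurable R)// /Zmeasurable/=.
rewrite (_ : _ @` _ = @Zset R `&` Y).
  apply: borel_lebesgue_measurable; apply: measurableI => //.
  exact: measurable_itv.
apply/seteqP; split=> [_ [z Yz <-]|z [Zz Yz]].
  by split => //; exact: set_mem (valP z).
by exists (exist _ z (mem_set Zz)).
Qed.

Lemma measurable_valV n :
  measurable_fun setT (fun z : Zspace R => (val z)^-1 ^+ n : R).
Proof.
apply: measurable_funX.
apply: (@measurable_comp _ _ _ _ _ _ (@Zset R) (@GRing.inv R)).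
- exact: measurable_itv.
- by move=> _ [z _ <-]; exact: set_mem (valP z).
- apply: subspace_continuous_measurable_fun; first exact: measurable_itv.
  apply: continuous_in_subspaceT => z; rewrite inE => /Zset_gt0 z0.
  by apply: inv_continuous; rewrite gt_eqF.
- exact: measurable_val.
Qed.

Lemma g_evenE n (z : Zspace R) : g_even n z =
  \sum_(k < n.+1) (-1) ^+ k * 'C(2 * n - k, k)%:R * (val z)^-1 ^+ (n - k).
Proof.
apply: eq_bigr => k _; congr *%R.
have kn : (k <= n)%N by rewrite -ltnS.
by rewrite exprVn exprnN -subzn// opprB.
Qed.

Lemma measurable_g_even n : measurable_fun setT (@g_even R n).
Proof.
have -> : @g_even R n = fun z => \sum_(k < n.+1)
    (-1) ^+ k * 'C(2 * n - k, k)%:R * (val z)^-1 ^+ (n - k).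
  by apply/funext => z; exact: g_evenE.
apply: (@measurable_sum _ (Zspace R) R setT 'I_n.+1) => k.
apply: measurable_funM; first exact: measurable_cst.
exact: measurable_valV.
Qed.

Lemma g_even_bounded n : exists B : R, forall z, `|@g_even R n z| <= B.
Proof.
exists (\sum_(k < n.+1) 'C(2 * n - k, k)%:R * 4 ^+ (n - k)) => z.
rewrite g_evenE (le_trans (ler_norm_sum _ _ _))//; apply: ler_sum => k _.
rewrite normrM normrMsign ger0_norm// ler_wpM2l//.
have /Zset_ge z4 := set_mem (valP z).
have z0 : 0 < val z by apply: lt_le_trans z4; rewrite invr_gt0.
have zV4 : (val z)^-1 <= 4 by rewrite -[leRHS]invrK lef_pV2// posrE invr_gt0.
by rewrite normrX lerXn2r ?nnegrE// ger0_norm// invr_ge0 ltW.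
Qed.

Let f0 (x : R) : R := (x * Num.sqrt x)^-1.
Let F0 (x : R) : R := - (2 * (Num.sqrt x)^-1).

Let continuous_f0 (x : R) : 0 < x -> {for x, continuous f0}.
Proof.
move=> x0; apply: cvgV; first by rewrite mulf_neq0 ?gt_eqF// sqrtr_gt0.
by apply: cvgM; [exact: cvg_id|exact: sqrt_continuous].
Qed.

Let continuous_F0 (x : R) : 0 < x -> {for x, continuous F0}.
Proof.
move=> x0; apply: cvgN; apply: cvgM; first exact: cvg_cst.
by apply: cvgV; [rewrite gt_eqF// sqrtr_gt0|exact: sqrt_continuous].
Qed.

Let is_derive_F0 (x : R) : 0 < x -> is_derive x 1 F0 (f0 x).
Proof.
move=> x0.
have s0 : Num.sqrt x != 0 by rewrite gt_eqF// sqrtr_gt0.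
have D1 := is_derive1_sqrt x0.
have D2 := is_deriveV s0 D1.
have D3 := is_deriveZ 2 D2.
have D4 := is_deriveN D3.
apply: is_derive_eq D4 _.
move: (sqr_sqrtr (ltW x0)) s0; rewrite /f0; set s := Num.sqrt x => <- s0.
rewrite -[LHS]/(- (2 * (- s ^- 2 * (2 * s)^-1))).
by field; rewrite s0.
Qed.

Let integral_f0 : (\int[@lebesgue_measure R]_(x in @Zset R) (f0 x)%:E < +oo)%E.
Proof.
have q0 : 0 < 4^-1 :> R by rewrite invr_gt0.
rewrite (@ge0_continuous_FTC2y _ f0 F0 4^-1 0).
- by rewrite ltry.
- by move=> x x4; rewrite invr_ge0 mulr_ge0// (le_trans (ltW q0)).
- apply: continuous_in_subspaceT => x; rewrite inE => /Zset_gt0.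
  exact: continuous_f0.
- apply/cvgrPdist_lt => e e0; near=> x.
  have e2 : 0 <= 2 / e by rewrite divr_ge0// ltW.
  have x_gt0 : 0 < x by near: x; exact: nbhs_pinfty_gt.
  have s2e : 2 / e < Num.sqrt x.
    rewrite -[ltLHS]ger0_norm// -sqrtr_sqr ltr_sqrt//.
    by near: x; apply: nbhs_pinfty_gt; exact: num_real.
  have s0 : 0 < Num.sqrt x by rewrite (le_lt_trans _ s2e).
  rewrite sub0r opprK ger0_norm; last by rewrite divr_ge0// ltW.
  by rewrite ltr_pdivrMr// mulrC -ltr_pdivrMr.
- by move=> x x4; have [] := is_derive_F0 (lt_trans q0 x4).
- apply: cvg_at_right_filter; exact: continuous_F0.
- move=> x; rewrite in_itv/= andbT => x4.
  by rewrite derive1E; have [_ ->] := is_derive_F0 (lt_trans q0 x4).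
Unshelve. all: by end_near. Qed.

Let Zdensity_le (x : R) : Zset x -> Zdensity x <= f0 x.
Proof.
move=> Zx; have x0 := Zset_gt0 Zx.
have s0 : 0 < Num.sqrt x by rewrite sqrtr_gt0.
rewrite /Zdensity /f0 ler_pdivrMr; last first.
  by rewrite !mulr_gt0// pi_gt0.
have -> : (x * Num.sqrt x)^-1 * (2 * pi * x ^+ 2) = 2 * pi * Num.sqrt x.
  move: (sqr_sqrtr (ltW x0)); set s := Num.sqrt x => <-.
  by field; rewrite gt_eqF.
apply: (@le_trans _ _ (Num.sqrt (4 * x))).
  by rewrite ler_wsqrtr// gerBl.
rewrite sqrtrM// (_ : 4 = 2 ^+ 2) ?sqrtr_sqr ?ger0_norm//; last by rewrite -natrX.
rewrite ler_wpM2r ?sqrtr_ge0// ler_peMr//.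
by rewrite (le_trans _ (pi_ge2 R))// ler1n.
Qed.

Lemma Zmu_fin : (@Zmu R setT < +oo)%E.
Proof.
rewrite /Zmu (_ : _ @` setT = @Zset R); last first.
  apply/seteqP; split=> [|z Zz]; first exact: vimage_Zset.
  by exists (exist _ z (mem_set Zz)).
have mId : @measurable_fun _ _ lebesgueT (measurableTypeR R) setT id.
  by move=> _ Y mY; rewrite setTI; exact: borel_lebesgue_measurable.
have mZ : @measurable _ (measurableTypeR R) (@Zset R) by exact: measurable_itv.
have mD : @measurable_fun _ _ (measurableTypeR R) _ (@Zset R) (EFin \o @Zdensity R).
  by apply/measurable_EFinP; exact: measurable_Zdensity.
have mf0 : @measurable_fun _ _ (measurableTypeR R) _ (@Zset R) (EFin \o f0).
  apply/measurable_EFinP.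
  apply: subspace_continuous_measurable_fun; first exact: measurable_itv.
  apply: continuous_in_subspaceT => z; rewrite inE => /Zset_gt0.
  exact: continuous_f0.
have H := @ge0_integral_pushforward _ _ lebesgueT (measurableTypeR R) R id mId
    (@completed_lebesgue_measure R) (@Zset R) (EFin \o @Zdensity R) mZ mD
    (fun z _ => Zdensity_ge0 z).
have -> : (\int[@completed_lebesgue_measure R]_(z in @Zset R) (Zdensity z)%:E =
    \int[@lebesgue_measure R]_(z in @Zset R) (Zdensity z)%:E)%E.
  symmetry; exact: H.
apply: le_lt_trans integral_f0; apply: ge0_le_integral => //.
by move=> z _; rewrite lee_fin Zdensity_ge0.
Qed.

Lemma g_even_finite_norm n : finite_norm (@Zmu R) 2%:E (@g_even R n).
Proof.
have [B gB] := g_even_bounded n.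
exact: (bounded_finite_norm Zmu_fin (measurable_g_even n) gB).
Qed.

HB.instance Definition _ n :=
  isMeasurableFun.Build _ _ (Zspace R) R (@g_even R n) (measurable_g_even n).
HB.instance Definition _ n :=
  isLfunction.Build _ (Zspace R) R (@Zmu R) _ (lee1n 2) (@g_even R n)
    (g_even_finite_norm n).

(* The element of L^2 represented by [g_even n]. *)
Definition g_even_L2 (n : nat) : LspaceType2 (@Zmu R) := L2_class (@g_even R n).

End g_even_L2.

(* Main.v *)
(* Put [z^-1 = 4 cos^2 t] with [0 <= t < pi/2]. Then [mu] becomes
   [4/pi sin^2 t dt] and [sin t * g_{2n} = sin ((2n+1) t)], because [g_{2n}] is
   the Chebyshev polynomial of the second kind [U_{2n}] at [cos t]; this gives
   orthonormality.
   For maximality, [g_{2n}] is a monic polynomial of degree [n] in [z^-1], so an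
   [f] orthogonal to all of them is orthogonal to all polynomials in [z^-1].
   Bounded pointwise limits of such polynomials include the indicators of
   [{z > c}], hence [f] has integral zero over these sets, then over all Borel
   sets by Dynkin's lemma, then over all Lebesgue measurable sets since those
   are Borel up to a null set; so [f = 0] almost everywhere. *)
From HB Require Import structures.
Require Import Defs.
From mathcomp Require Import all_boot all_order all_algebra.
From mathcomp Require Import all_classical all_reals all_analysis.
From mathcomp Require Import measurable_realfun zify ring lra.

Set Implicit Arguments.
Unset Strict Implicit.
Unset Printing Implicit Defensive.

Import Order.TTheory GRing.Theory Num.Theory.
Import numFieldNormedType.Exports.

Local Open Scope classical_set_scope.
Local Open Scope ring_scope.

(** * Chebyshev polynomials of the second kind *)

(** This is U_n at y / 2. The exponent [n - k.*2] truncates to 0 when 2k > n, harmlessly, since then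
    n - k < k and the binomial vanishes. *)
Definition cheb (R : comRingType) (n : nat) (y : R) : R :=
  \sum_(k < n.+1) (-1) ^+ k * 'C(n - k, k)%:R * y ^+ (n - k.*2).

(** Pascal's rule splits each coefficient in two: one half gives [y * cheb n.+1 y], the other, after
    shifting k by one, gives [- cheb n y]. *)
Lemma cheb_rec (R : comRingType) n (y : R) :
  cheb n.+2 y = y * cheb n.+1 y - cheb n y.
Proof.
rewrite /cheb mulr_sumr -sumrN.
have -> : \sum_(k < n.+3) (-1) ^+ k * 'C(n.+2 - k, k)%:R * y ^+ (n.+2 - k.*2) =
    \sum_(k < n.+3) (-1) ^+ k * 'C(n.+1 - k, k)%:R * y ^+ (n.+2 - k.*2) +
    \sum_(k < n.+3 | (0 < k)%N)
      (-1) ^+ k * 'C(n.+1 - k, k.-1)%:R * y ^+ (n.+2 - k.*2).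
  rewrite [X in _ = _ + X]big_mkcond -big_split; apply: eq_bigr => -[[|k]/= kn] _.
    by rewrite !subn0 !bin0 addr0.
  have [kn1|kn1] := leqP k n; first by rewrite subSn// binS natrD mulrDr mulrDl.
  have -> : k = n.+1 by lia.
  rewrite subnn (_ : (n.+1 - n.+2 = 0)%N); last by lia.
  by rewrite !bin0n !mulr0 !mul0r addr0.
congr +%R.
  rewrite big_ord_recr/= (_ : (n.+1 - n.+2 = 0)%N); last by lia.
  rewrite bin0n mulr0 mul0r addr0; apply: eq_bigr => k _.
  have [kn|kn] := leqP k.*2 n.+1.
    by rewrite (subSn kn) exprS mulrCA.
  by rewrite bin_small ?mulr0 ?mul0r ?mulr0//; have := ltn_ord k; lia.
rewrite big_mkcond big_ord_recl/= add0r big_ord_recr/=.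
rewrite (_ : (n.+1 - bump 0 n.+1 = 0)%N)// 1?bin0n; last first.
  by rewrite /bump; lia.
rewrite mulr0 mul0r addr0; apply: eq_bigr => k _.
rewrite /bump/= add1n/= subSS exprS mulN1r !mulNr doubleS.
by rewrite !subSS.
Qed.

(** By the addition formulas, both sides satisfy s_{n+2} = 2 cos t s_{n+1} - s_n, so two initial
    values suffice. *)
Lemma sin_mul_cheb (R : realType) n (t : R) :
  sin t * cheb n (2 * cos t) = sin (n.+1%:R * t).
Proof.
have c0 : cheb 0 (2 * cos t) = 1.
  by rewrite /cheb big_ord1/= bin0 !mulr1 expr0.
have c1 : cheb 1 (2 * cos t) = 2 * cos t.
  rewrite /cheb big_ord_recr big_ord1/= !bin0 !mul1r.
  by rewrite subnn bin0n mulr0 mul0r addr0.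
suff : sin t * cheb n (2 * cos t) = sin (n.+1%:R * t) /\
   sin t * cheb n.+1 (2 * cos t) = sin (n.+2%:R * t) by case.
elim: n => [|n [IH1 IH2]].
  rewrite c0 c1 mul1r mulr1; split => //.
  by rewrite [X in _ = sin X]mulr_natl sin_mulr2n; ring.
split => //; rewrite cheb_rec mulrBr IH1 mulrCA IH2.
have -> : n.+3%:R * t = n.+2%:R * t + t by rewrite -natr1; ring.
have -> : n.+1%:R * t = n.+2%:R * t - t.
  by rewrite -[in RHS]natr1; ring.
by rewrite sinB sinD; ring.
Qed.

Definition g_poly (R : nzRingType) (n : nat) : {poly R} :=
  \sum_(k < n.+1) ((-1) ^+ k * 'C(2 * n - k, k)%:R) *: 'X^(n - k).

Lemma g_evenE_poly (R : realType) n (z : Zspace R) :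
  g_even n z = (g_poly R n).[(val z)^-1].
Proof.
rewrite g_evenE /g_poly horner_sum; apply: eq_bigr => k _.
by rewrite hornerZ hornerXn.
Qed.

(** The term k = 0 is ['X^n], so [g_poly R n] is monic of degree n and can cancel leading terms. *)
Lemma size_g_poly_sub (R : nzRingType) n : (size (g_poly R n - 'X^n)%R <= n)%N.
Proof.
rewrite /g_poly big_ord_recl/= expr0 subn0 bin0 mul1r scale1r subn0 addrAC subrr add0r.
rewrite (leq_trans (size_sum _ _ _))//; apply/bigmax_leqP => k _.
rewrite (leq_trans (size_scale_leq _ _))// size_polyXn /bump/=.
by have := ltn_ord k; lia.
Qed.

(** The summands of [cheb n.*2] with k > n vanish, and the others are even powers of y. *)
Lemma horner_g_poly_sqr (R : comRingType) n (y : R) :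
  (g_poly R n).[y ^+ 2] = cheb n.*2 y.
Proof.
rewrite /g_poly horner_sum /cheb.
under eq_bigr do rewrite hornerZ hornerXn.
rewrite -(big_mkord xpredT
  (fun k => (-1) ^+ k * 'C(2 * n - k, k)%:R * (y ^+ 2) ^+ (n - k))).
rewrite -(big_mkord xpredT
  (fun k => (-1) ^+ k * 'C(n.*2 - k, k)%:R * y ^+ (n.*2 - k.*2))).
rewrite [RHS](@big_cat_nat _ _ _ n.+1)//=; last by rewrite ltnS -addnn leq_addr.
rewrite [X in _ = _ + X]big_nat_cond [X in _ = _ + X]big1 ?addr0; last first.
  move=> k /andP[/andP[nk kn] _].
  by rewrite bin_small ?mulr0 ?mul0r//; lia.
by apply: eq_big_nat => k kn; rewrite -exprM mul2n; congr (_ * _ ^+ _); lia.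
Qed.

(** * Integrals against mu as Lebesgue integrals with a density *)

Section Zmu_density.
Variable R : realType.
Local Notation mu := (@lebesgue_measure R).
Local Notation lebesgueT := (caratheodory_type (@wlength R idfun)^*%mu).

(** Lebesgue measure on Borel sets is the pushforward of its completion under the identity map. *)
Lemma integral_completed_lebesgue (D : set R) (f : R -> \bar R) :
  measurable D -> measurable_fun D f -> {in D, forall x, 0 <= f x}%E ->
  (\int[@completed_lebesgue_measure R]_(x in D) f x = \int[mu]_(x in D) f x)%E.
Proof.
move=> mD mf f0.
have mId : @measurable_fun _ _ lebesgueT (measurableTypeR R) setT id.
  by move=> _ Y mY; rewrite setTI; exact: borel_lebesgue_measurable.
exact: esym (@ge0_integral_pushforward _ _ lebesgueT (measurableTypeR R) R id
  mId (@completed_lebesgue_measure R) D f mD mf f0).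
Qed.

Lemma image_val_preimage (A : set R) :
  (val : Zspace R -> R) @` (val @^-1` A) = A `&` @Zset R.
Proof.
apply/seteqP; split=> [_ [z Az <-]|z [Az Zz]].
  by split => //; exact: set_mem (valP z).
by exists (exist _ z (mem_set Zz)).
Qed.

Lemma Zmu_preimage_val (A : set R) : measurable A ->
  Zmu (val @^-1` A) = (\int[mu]_(x in A `&` @Zset R) (Zdensity x)%:E)%E.
Proof.
move=> mA; rewrite /Zmu image_val_preimage.
have mAZ : measurable (A `&` @Zset R).
  by apply: measurableI => //; exact: measurable_itv.
apply: integral_completed_lebesgue => //.
  apply/measurable_EFinP; apply: measurable_funS (@measurable_Zdensity R) => //.
  exact: measurable_itv.
by move=> x _; rewrite lee_fin Zdensity_ge0.
Qed.

(** Moving mu to the Borel sets of the line makes the Radon-Nikodym theorem with respect to Lebesgue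
    measure applicable. *)
Definition Zlaw : set (measurableTypeR R) -> \bar R := pushforward (@Zmu R) val.

Lemma measurable_preimage_val (A : set (measurableTypeR R)) :
  measurable A -> measurable (val @^-1` A : set (Zspace R)).
Proof. by move=> mA; rewrite -[X in measurable X]setTI; exact: measurable_val. Qed.

Let Zlaw0 : Zlaw set0 = 0%E.
Proof. by rewrite /Zlaw /pushforward preimage_set0 measure0. Qed.

Let Zlaw_ge0 A : (0 <= Zlaw A)%E.
Proof. by rewrite /Zlaw /pushforward measure_ge0. Qed.

Let Zlaw_sigma_additive : semi_sigma_additive Zlaw.
Proof.
move=> F mF tF mUF; rewrite /Zlaw /pushforward preimage_bigcup.
apply: measure_semi_sigma_additive.
- move=> n. exact: measurable_preimage_val (mF n).
- apply/trivIsetP => i j _ _ ij; rewrite -preimage_setI.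
  by move/trivIsetP : tF => ->//; rewrite preimage_set0.
- by rewrite -preimage_bigcup; exact: measurable_preimage_val.
Qed.

HB.instance Definition _ := isMeasure.Build _ _ _ Zlaw
  Zlaw0 Zlaw_ge0 Zlaw_sigma_additive.

Lemma Zlaw_fin : fin_num_fun Zlaw.
Proof.
apply: lty_fin_num_fun; exact: Zmu_fin.
Qed.

HB.instance Definition _ := Measure_isFinite.Build _ _ _ Zlaw Zlaw_fin.

Lemma Zlaw_dominated : Zlaw `<< mu.
Proof.
apply/null_content_dominatesP => A mA muA0; rewrite /Zlaw /pushforward.
rewrite Zmu_preimage_val//.
have mAZ : measurable (A `&` @Zset R).
  by apply: measurableI => //; exact: measurable_itv.
apply: null_set_integral => //.
  apply/measurable_EFinP; apply: measurable_funS (@measurable_Zdensity R) => //.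
  exact: measurable_itv.
by apply/eqP; rewrite eq_le measure_ge0 andbT -muA0 measureIl//; exact: measurable_itv.
Qed.

(** The Radon-Nikodym derivative of [Zlaw] agrees almost everywhere on [Zset] with [Zdensity],
    because both have the same integral over every Borel subset of [Zset]. *)
Lemma integral_Zmu (h : R -> \bar R) :
  measurable_fun (@Zset R) h -> (forall x, Zset x -> 0 <= h x)%E ->
  (\int[@Zmu R]_z h (val z) =
   \int[mu]_(x in @Zset R) (h x * (Zdensity x)%:E))%E.
Proof.
move=> mh h0.
have mZ : measurable (@Zset R) by exact: measurable_itv.
have mD : measurable_fun (@Zset R) (EFin \o @Zdensity R).
  by apply/measurable_EFinP; exact: measurable_Zdensity.
(* The change of variables asks for nonnegativity on the whole line, while [h] is nonnegative only
   on [Zset]. *)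
pose k := (fun x => `|h x|)%E.
have mk : measurable_fun (@Zset R) k by exact: measurableT_comp.
have Zval : val @^-1` (@Zset R) = [set: Zspace R].
  by apply/seteqP; split => // z _; exact: set_mem (valP z).
transitivity (\int[Zlaw]_(x in @Zset R) k x)%E.
  rewrite ge0_integral_pushforward//; [|exact: measurable_val|]; last first.
    by move=> x _; exact: abse_ge0.
  rewrite Zval; apply: eq_integral => z _ /=; rewrite /k gee0_abs// h0//.
  exact: set_mem (valP z).
rewrite -(Radon_Nikodym_SigmaFinite.change_of_variables Zlaw_dominated)//; last first.
  by move=> x; exact: abse_ge0.
have iRN := Radon_Nikodym_SigmaFinite.f_integrable Zlaw_dominated.
transitivity (\int[mu]_(x in @Zset R) (k x * (Zdensity x)%:E))%E; last first.
  by apply: eq_integral => x; rewrite inE => Zx; rewrite /k gee0_abs// h0.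
apply: ae_eq_integral => //.
- apply: emeasurable_funM => //; apply: (measurable_int mu).
  exact: integrableS iRN.
- exact: emeasurable_funM.
- apply: ae_eqe_mul2l; apply: integral_ae_eq => //.
  + exact: integrableS iRN.
  + move=> E EZ mE; rewrite -Radon_Nikodym_SigmaFinite.f_integral//.
      by rewrite -[LHS]/(Zmu (val @^-1` E)) Zmu_preimage_val// setIidl.
    exact: Zlaw_dominated.
Qed.

End Zmu_density.

(** * The trigonometric substitution and the integrals of products *)

Section trig_substitution.
Variable R : realType.

(** For z at least 1/4 this is the t in [0, pi/2[ with z^-1 = 4 cos^2 t, since that equation means
    tan^2 t = 4z - 1. *)
Definition Ztheta (z : R) : R := atan (Num.sqrt (4 * z - 1)).

Lemma continuous_Ztheta : continuous Ztheta.
Proof.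
move=> z; apply: (@continuous_comp _ _ _ (fun z : R => Num.sqrt (4 * z - 1)) atan).
  apply: (@continuous_comp _ _ _ (fun z : R => 4 * z - 1) Num.sqrt).
    by apply: cvgB; [apply: cvgM; [exact: cvg_cst|exact: cvg_id]|exact: cvg_cst].
  exact: sqrt_continuous.
exact: continuous_atan.
Qed.

Lemma Ztheta_min : Ztheta 4^-1 = 0.
Proof. by rewrite /Ztheta divff// subrr sqrtr0 atan0. Qed.

Lemma cvgy_Ztheta : Ztheta z @[z --> +oo] --> pi / 2.
Proof.
apply: (@cvg_comp _ _ _ (fun z : R => Num.sqrt (4 * z - 1)) atan _ +oo);
  last exact: cvgy_atan.
apply/cvgryPge => A; near=> z.
have z0 : 0 <= 4 * z - 1.
  suff : 1 <= z by lra.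
  by near: z; apply: nbhs_pinfty_ge; exact: num_real.
rewrite (le_trans (ler_norm A))// -sqrtr_sqr ler_wsqrtr//.
suff : A ^+ 2 + 1 <= z by have := sqr_ge0 A; lra.
by near: z; apply: nbhs_pinfty_ge; exact: num_real.
Unshelve. all: by end_near. Qed.

Lemma is_derive_Ztheta (z : R) : 4^-1 < z ->
  is_derive z 1 Ztheta (2 * z * Num.sqrt (4 * z - 1))^-1.
Proof.
move=> z4; have z1 : 0 < 4 * z - 1 by lra.
have z0 : 0 < z by lra.
have D1 : is_derive z 1 (fun z : R => 4 * z - 1) 4.
  have D := is_deriveB (is_deriveZ (4 : R) (is_derive_id z (1 : R)))
    (is_derive_cst (1 : R) z (1 : R)).
  by apply: is_derive_eq D _; rewrite subr0 [LHS]mulr1.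
have D2 := @is_derive1_comp R Num.sqrt (fun z => 4 * z - 1) z _ _
  (is_derive1_sqrt z1) D1.
have D3 := @is_derive1_comp R atan (Num.sqrt \o (fun z => 4 * z - 1)) z _ _
  (is_derive1_atan _) D2.
apply: is_derive_eq D3 _.
rewrite /= sqr_sqrtr ?(ltW z1)// addrC subrK.
have : Num.sqrt (4 * z - 1) != 0 by rewrite gt_eqF// sqrtr_gt0.
by move=> s0; field; rewrite s0 gt_eqF.
Qed.

Lemma cos_Ztheta_sqr (z : R) : 4^-1 <= z -> (2 * cos (Ztheta z)) ^+ 2 = z^-1.
Proof.
move=> z4; rewrite /Ztheta cos_atan sqr_sqrtr; last by lra.
rewrite addrC subrK exprMn exprVn sqr_sqrtr; last by lra.
by field; rewrite gt_eqF//; lra.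
Qed.

Lemma sin_Ztheta_sqr (z : R) : 4^-1 <= z ->
  sin (Ztheta z) ^+ 2 = (4 * z - 1) / (4 * z).
Proof.
move=> z4; rewrite sin2cos2.
have -> : cos (Ztheta z) ^+ 2 = (2 * cos (Ztheta z)) ^+ 2 / 4 by field.
by rewrite cos_Ztheta_sqr//; field; rewrite gt_eqF//; lra.
Qed.

Lemma sin_mul_g_poly n (z : R) : 4^-1 <= z ->
  sin (Ztheta z) * (g_poly R n).[z^-1] = sin ((2 * n + 1)%:R * Ztheta z).
Proof.
move=> z4; rewrite -cos_Ztheta_sqr// horner_g_poly_sqr sin_mul_cheb.
by rewrite addn1 mul2n.
Qed.

(* The primitive of [t |-> cos (2 * k * t)] that vanishes at 0; for [k = 0] the
   second summand is [0 / 0 = 0]. *)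
Definition cos_primitive (k : nat) (t : R) : R :=
  (k == 0)%:R * t + sin (2 * k%:R * t) / (2 * k%:R).

Lemma is_derive_cos_primitive k (t : R) :
  is_derive t 1 (cos_primitive k) (cos (2 * k%:R * t)).
Proof.
have D1 : is_derive t 1 (fun t : R => 2 * k%:R * t) (2 * k%:R).
  have D := is_deriveZ (2 * k%:R : R) (is_derive_id t (1 : R)).
  by apply: is_derive_eq D _; rewrite [LHS]mulr1.
have D2 := @is_derive1_comp R sin (fun t => 2 * k%:R * t) t _ _
  (is_derive_sin _) D1.
have D3 := is_deriveD (is_deriveZ ((k == 0)%:R : R) (is_derive_id t (1 : R)))
  (is_deriveZ (2 * k%:R : R)^-1 D2).
have -> : cos_primitive k = (k == 0)%:R \*: id +
    (2 * k%:R)^-1 \*: (sin \o (fun t => 2 * k%:R * t)).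
  by apply/funext => x; rewrite /cos_primitive [X in _ + X]mulrC.
apply: is_derive_eq D3 _; rewrite -![_ *: _]/(_ * _) mulr1.
case: k D1 D2 => [|k] _ _.
  by rewrite !mulr0 mul0r cos0 addr0.
by rewrite add0r mulrCA mulVf ?mulr1// mulf_neq0// pnatr_eq0.
Qed.

Lemma continuous_cos_primitive k : continuous (cos_primitive k).
Proof.
move=> t; apply: differentiable_continuous; apply/derivable1_diffP.
by have [] := is_derive_cos_primitive k t.
Qed.

Lemma cos_primitive0 k : cos_primitive k 0 = 0.
Proof. by rewrite /cos_primitive !mulr0 sin0 mul0r addr0. Qed.

Lemma sin_natpi n : sin (n%:R * pi) = 0 :> R.
Proof.
elim: n => [|n IH]; first by rewrite mul0r sin0.
by rewrite -natr1 mulrDl mul1r sinDpi IH oppr0.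
Qed.

(** The source of orthogonality: over [0, pi/2] only the frequency k = 0 has a nonzero integral. *)
Lemma cos_primitive_pihalf k : cos_primitive k (pi / 2) = (k == 0)%:R * (pi / 2).
Proof.
rewrite /cos_primitive (_ : 2 * k%:R * (pi / 2) = k%:R * pi); last by field.
by rewrite sin_natpi mul0r addr0.
Qed.

Lemma sin_mul_sin (a b : R) : sin a * sin b = (cos (a - b) - cos (a + b)) / 2.
Proof. by rewrite cosB cosD; field. Qed.

Lemma continuous_Zdensity_poly (p : {poly R}) :
  {within `[4^-1, +oo[, continuous (fun z => p.[z^-1] * Zdensity z)}.
Proof.
apply: continuous_in_subspaceT => z; rewrite inE => /Zset_gt0 z0.
apply: cvgM; last exact: continuous_Zdensity.
apply: (@continuous_comp _ _ _ (@GRing.inv R) (horner p)).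
  by apply: inv_continuous; rewrite gt_eqF.
exact: continuous_horner.
Qed.

(* The constant [B] makes the integrand nonnegative, as required by the
   fundamental theorem of calculus on an unbounded interval. *)
Lemma integral_g_poly_mul n m (B : R) : (m <= n)%N ->
  (forall z, 4^-1 <= z -> 0 <= (g_poly R n * g_poly R m + B%:P).[z^-1]) ->
  (\int[@Zmu R]_z ((g_poly R n * g_poly R m + B%:P).[(val z)^-1])%:E =
   ((n == m)%:R + B)%:E)%E.
Proof.
move=> mn; set p := (_ + _) => p0.
(* In the variable t the integrand is 4/pi (sin (2n+1)t sin (2m+1)t + B sin^2 t). Product-to-sum
   formulas turn it into cosines of 2(n-m)t, 2(n+m+1)t, 0 and 2t, whose primitive is [P]. *)
pose P t := 2 / pi * (cos_primitive (n - m) t - cos_primitive (n + m).+1 t) +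
  B * (2 / pi * (cos_primitive 0 t - cos_primitive 1 t)).
have pi0 : (pi : R) != 0 by rewrite gt_eqF// pi_gt0.
have mp : measurable_fun (@Zset R) (fun z => p.[z^-1]).
  apply: subspace_continuous_measurable_fun; first exact: measurable_itv.
  apply: continuous_in_subspaceT => z; rewrite inE => /Zset_gt0 z0.
  apply: (@continuous_comp _ _ _ (@GRing.inv R) (horner p)).
    by apply: inv_continuous; rewrite gt_eqF.
  exact: continuous_horner.
rewrite (@integral_Zmu _ (fun z => (p.[z^-1])%:E)); last 2 first.
- exact/measurable_EFinP.
- by move=> z /Zset_ge z4; rewrite lee_fin p0.
under eq_integral do rewrite -EFinM.
have cP : continuous P.
  move=> t; apply: cvgD; apply: cvgM; try exact: cvg_cst.
    by apply: cvgB; exact: continuous_cos_primitive.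
  by apply: cvgM; [exact: cvg_cst|apply: cvgB; exact: continuous_cos_primitive].
have P0 : P 0 = 0 by rewrite /P !cos_primitive0 !subrr !mulr0 addr0.
have Ppi : P (pi / 2) = (n == m)%:R + B.
  rewrite /P !cos_primitive_pihalf/= subn_eq0 (_ : (n <= m)%N = (n == m)).
    by move: (pi : R) pi0 => q q0; field.
  by rewrite eqn_leq mn andbT.
have dP (z : R) : 4^-1 < z ->
    is_derive z 1 (P \o Ztheta) (p.[z^-1] * Zdensity z).
  move=> z4.
  set t := Ztheta z.
  have D := is_derive_cos_primitive ^~ t.
  have D1 := is_deriveZ (2 / pi : R) (is_deriveB (D (n - m)%N) (D (n + m).+1)).
  have D2 := is_deriveZ B (is_deriveZ (2 / pi : R) (is_deriveB (D 0%N) (D 1%N))).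
  have D3 := @is_derive1_comp R P Ztheta z _ _ (is_deriveD D1 D2)
    (is_derive_Ztheta z4).
  apply: is_derive_eq D3 _; rewrite -![_ *: _]/(_ * _).
  have sn := sin_mul_g_poly n (ltW z4); have sm := sin_mul_g_poly m (ltW z4).
  have s2 := sin_Ztheta_sqr (ltW z4).
  have z0 : z != 0 by rewrite gt_eqF//; lra.
  have r0 : Num.sqrt (4 * z - 1) != 0 by rewrite gt_eqF// sqrtr_gt0; lra.
  have r2 : Num.sqrt (4 * z - 1) ^+ 2 = 4 * z - 1 by rewrite sqr_sqrtr; lra.
  have -> : cos (2 * (n - m)%:R * t) - cos (2 * (n + m).+1%:R * t) =
      2 * (sin t ^+ 2 * ((g_poly R n).[z^-1] * (g_poly R m).[z^-1])).
    rewrite expr2 mulrACA sn sm sin_mul_sin -mulrBl -mulrDl natrB//.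
    rewrite -[(n + m).+1%:R]natr1 !natrD mulrCA divff ?mulr1//.
    by congr (cos (_ * _) - cos (_ * _)); ring.
  have -> : cos (2 * 0 * t) - cos (2 * 1 * t) = 2 * sin t ^+ 2.
    rewrite expr2 sin_mul_sin subrr mulr0 mul0r mulrCA divff ?mulr1//.
    by rewrite mulr_natl mulr2n.
  (* With 4z - 1 written as the square of its root, what remains is a rational identity in z, pi and
     that root. *)
  rewrite -[X in _ = X / _]r2 in s2; rewrite s2 /p hornerD hornerM hornerC /Zdensity.
  move: (pi : R) (Num.sqrt (4 * z - 1)) pi0 r0 => q r q0 r0.
  by field; rewrite z0 q0 r0.
transitivity ((P (pi / 2))%:E - ((P \o Ztheta) 4^-1)%:E)%E; last first.
  by rewrite /= Ztheta_min P0 Ppi sube0.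
apply: ge0_continuous_FTC2y.
- by move=> z z4; rewrite mulr_ge0 ?p0// Zdensity_ge0.
- exact: continuous_Zdensity_poly.
- by apply: cvg_comp cvgy_Ztheta _; exact: cP.
- by move=> z /dP[].
- apply: cvg_at_right_filter; apply: continuous_comp; first exact: continuous_Ztheta.
  exact: cP.
- by move=> z; rewrite in_itv/= andbT => /dP[_ <-]; rewrite derive1E.
Qed.

End trig_substitution.

(** * Powers that converge to a step function *)

Lemma bernoulli_ineq (R : realDomainType) (t : R) n :
  -1 <= t -> 1 + n%:R * t <= (1 + t) ^+ n.
Proof.
move=> t1; elim: n => [|n IH]; first by rewrite mul0r addr0 expr0.
rewrite exprS; apply: (@le_trans _ _ ((1 + t) * (1 + n%:R * t))); last first.
  by rewrite ler_wpM2l//; lra.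
have : 0 <= n%:R * t ^+ 2 by rewrite mulr_ge0// sqr_ge0.
by rewrite -natr1; lra.
Qed.

(** For r > 0 put s = sqrt r. Bernoulli's inequality for s^-1 bounds n s^n by 1 / (s^-1 - 1), and n
    r^n is this bounded quantity times s^n. *)
Lemma cvg_natmul_expr0 (R : realType) (r : R) : 0 <= r < 1 ->
  n%:R * r ^+ n @[n --> \oo] --> 0.
Proof.
move=> /andP[]; rewrite le_eqVlt => /predU1P[<- _|r0 r1].
  rewrite [X in X @ _](_ : _ = cst 0); first exact: cvg_cst.
  by apply/funext => -[|n]; rewrite /cst ?mul0r// expr0n mulr0.
have s0 : 0 < Num.sqrt r by rewrite sqrtr_gt0.
have s1 : Num.sqrt r < 1 by rewrite -sqrtr1 ltr_sqrt.
have := sqr_sqrtr (ltW r0); move: (Num.sqrt r) s0 s1 => s s0 s1 <-.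
have t0 : 0 < s^-1 - 1 by rewrite subr_gt0 invf_gt1.
have cs : s ^+ n * (s^-1 - 1)^-1 @[n --> \oo] --> 0.
  rewrite -[X in _ --> X](mul0r (s^-1 - 1)^-1); apply: cvgM; last exact: cvg_cst.
  by apply: cvg_expr; rewrite ger0_norm// ltW.
apply: squeeze_cvgr (cvg_cst 0) cs; apply: nearW => n.
have sn0 k : 0 <= s ^+ k by rewrite exprn_ge0// ltW.
rewrite -exprM mulr_ge0//=.
rewrite mul2n -addnn exprD mulrCA ler_wpM2l//.
rewrite -[leRHS]mul1r ler_pdivlMr// mulrAC -ler_pdivlMr ?exprn_gt0//.
rewrite mul1r -exprVn -[s^-1 in leRHS](subrKC 1).
by apply: le_trans (bernoulli_ineq _ _); lra.
Qed.

(* The exponent [n * 2 ^ n], rather than the more usual [2 ^ n], gives the limit 0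
   at the threshold [2^-1] as well. *)
Lemma cvg_step_expr (R : realType) (y : R) : 0 <= y <= 1 ->
  (1 - y ^+ n) ^+ (n * 2 ^ n) @[n --> \oo] --> ((y < 2^-1)%R%:R : R).
Proof.
move=> /andP[y0 y1].
have yn0 n : 0 <= y ^+ n by rewrite exprn_ge0.
have yn1 n : y ^+ n <= 1 by rewrite exprn_ile1.
have [y2|y2] := ltP y 2^-1.
  (* Below the threshold, Bernoulli's inequality gives the lower bound 1 - n (2y)^n, and 2y < 1. *)
  have c : 1 - n%:R * (2 * y) ^+ n @[n --> \oo] --> (1 : R).
    rewrite -[X in _ --> X]subr0; apply: cvgB; first exact: cvg_cst.
    by apply: cvg_natmul_expr0; lra.
  rewrite mulr1n; apply: (squeeze_cvgr _ c (cvg_cst (1 : R))); apply: nearW => n.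
  rewrite exprn_ile1 ?subr_ge0// ?andbT; last by rewrite gerBl.
  rewrite (le_trans _ (bernoulli_ineq _ _))//; last by rewrite lerN2.
  by rewrite natrM natrX exprMn mulrN mulrA.
have c : (n.+1%:R : R)^-1 @[n --> \oo] --> (0 : R) by exact: cvg_harmonic.
apply: squeeze_cvgr (cvg_cst 0) c; apply: nearW => n.
rewrite exprn_ge0 ?subr_ge0//=.
set N := (n * 2 ^ n)%N.
(* Put w = y^n. Since 2y >= 1, Bernoulli's inequality gives (1 + w)^N >= 1 + n (2y)^n >= n + 1. As
   (1 - w)^N (1 + w)^N = (1 - w^2)^N <= 1, the power (1 - w)^N is at most 1 / (n + 1). *)
have N1 : n.+1%:R <= (1 + y ^+ n) ^+ N.
  apply: le_trans (bernoulli_ineq _ _); last by rewrite (le_trans _ (yn0 n)).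
  rewrite natrM natrX -mulrA -exprMn -natr1 addrC lerD2l ler_peMr//.
  by rewrite exprn_ege1//; lra.
rewrite -[leRHS]mul1r ler_pdivlMr// (le_trans (ler_wpM2l _ N1))//.
  by rewrite exprn_ge0// subr_ge0.
have w2 : (y ^+ n) ^+ 2 <= 1 by rewrite exprn_ile1.
rewrite -exprMn exprn_ile1//; have := sqr_ge0 (y ^+ n); lra.
Qed.

(** * Integrable functions orthogonal to every g_{2n} *)

Lemma Zinv_itv (R : realType) (z : Zspace R) : 0 < (val z)^-1 <= 4.
Proof.
have /Zset_ge z4 := set_mem (valP z).
have z0 : 0 < val z by apply: lt_le_trans z4; rewrite invr_gt0.
by rewrite invr_gt0 z0 -[leRHS]invrK lef_pV2// posrE invr_gt0.
Qed.

Lemma measurable_poly_Zinv (R : realType) (p : {poly R}) :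
  measurable_fun setT (fun z : Zspace R => p.[(val z)^-1]).
Proof.
under eq_fun do rewrite horner_coef.
apply: (@measurable_sum _ (Zspace R) R setT 'I_(size p)) => k.
by apply: measurable_funM; [exact: measurable_cst|exact: measurable_valV].
Qed.

Lemma poly_Zinv_bounded (R : realType) (p : {poly R}) :
  exists B, forall z : Zspace R, `|p.[(val z)^-1]| <= B.
Proof.
exists (\sum_(k < size p) `|p`_k| * 4 ^+ k) => z.
have /andP[z0 z4] := Zinv_itv z.
rewrite horner_coef (le_trans (ler_norm_sum _ _ _))//; apply: ler_sum => k _.
by rewrite normrM ler_wpM2l// normrX lerXn2r ?nnegrE// gtr0_norm.
Qed.

Section orthogonal_to_polynomials.
Variables (R : realType) (f : Zspace R -> R).
Hypothesis intf : (@Zmu R).-integrable setT (EFin \o f).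
Local Notation Zmu := (@Zmu R).

Lemma integrable_mul_bounded (h : Zspace R -> R) (B : R) :
  measurable_fun setT h -> (forall z, `|h z| <= B) ->
  Zmu.-integrable setT (EFin \o (fun z => f z * h z)).
Proof.
move=> mh hB; apply: (@integrableMl _ _ _ Zmu setT measurableT (EFin \o f) h) => //.
exists B; split; first exact: num_real.
by move=> M BM z _ /=; rewrite (le_trans (hB z))// ltW.
Qed.

Lemma integrable_mul_poly (p : {poly R}) :
  Zmu.-integrable setT (EFin \o (fun z => f z * p.[(val z)^-1])).
Proof.
have [B pB] := poly_Zinv_bounded p.
exact: integrable_mul_bounded (measurable_poly_Zinv p) pB.
Qed.

Hypothesis fg : forall n, \int[Zmu]_z (f z * g_even n z) = 0.

(** Induction on a bound for the size: subtracting the right multiple of the monic [g_poly R n]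
    removes the coefficient of degree n. *)
Lemma integral_mul_poly0 (p : {poly R}) :
  \int[Zmu]_z (f z * p.[(val z)^-1]) = 0.
Proof.
move: {2}(size p) (leqnn (size p)) => n; elim: n p => [|n IH] p.
  rewrite leqn0 size_poly_eq0 => /eqP ->.
  under eq_Rintegral do rewrite horner0 mulr0.
  by rewrite /Rintegral integral0.
move=> pn.
pose q := p - p`_n *: g_poly R n.
have qn : (size q <= n)%N.
  rewrite (_ : q = (p - p`_n *: 'X^n) - p`_n *: (g_poly R n - 'X^n)); last first.
    by rewrite /q scalerBr opprB addrA subrK.
  rewrite (leq_trans (size_polyD _ _))// geq_max size_polyN.
  rewrite (leq_trans (size_scale_leq _ _) (size_g_poly_sub _ _)) andbT.
  apply/leq_sizeP => j nj; rewrite coefB coefZ coefXn.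
  have [->|jn] := eqVneq j n; first by rewrite mulr1 subrr.
  rewrite mulr0 subr0 nth_default// (leq_trans pn)// ltn_neqAle eq_sym jn//.
transitivity (\int[Zmu]_z
    (f z * q.[(val z)^-1] + p`_n * (f z * (g_poly R n).[(val z)^-1]))).
  apply: eq_Rintegral => z _; rewrite /q hornerD hornerN hornerZ; ring.
rewrite RintegralD//; last 2 first.
- exact: integrable_mul_poly.
- rewrite [X in _.-integrable _ X](_ : _ = (fun z => (p`_n)%:E *
    (EFin \o (fun z => (f z * (g_poly R n).[(val z)^-1])%R)) z)%E) //.
  by apply: integrableZl => //; exact: integrable_mul_poly.
rewrite IH// add0r RintegralZl//; last exact: integrable_mul_poly.
under eq_Rintegral do rewrite -g_evenE_poly.
by rewrite fg mulr0.
Qed.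

Lemma Rintegral_setT0 : \int[Zmu]_z f z = 0.
Proof.
rewrite -[RHS](integral_mul_poly0 1).
by apply: eq_Rintegral => z _; rewrite hornerC mulr1.
Qed.

(** For c at least 1/4, z > c means z^-1 < c^-1, and this step in z^-1 is a limit of polynomials
    with values in [0, 1]. Dominated convergence applies with dominating function |f|. For smaller c
    the set is the whole space. *)
Lemma Rintegral_tail0 (c : R) : \int[Zmu]_(z in val @^-1` `]c, +oo[) f z = 0.
Proof.
have [c4|c4] := ltP c 4^-1.
  have -> : val @^-1` `]c, +oo[ = [set: Zspace R].
    apply/seteqP; split=> // z _ /=; rewrite in_itv/= andbT (lt_le_trans c4)//.
    exact: Zset_ge (set_mem (valP z)).
  exact: Rintegral_setT0.
have c0 : 0 < c by rewrite (lt_le_trans _ c4)// invr_gt0.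
have cV4 : c^-1 <= 4 by rewrite -[leRHS]invrK lef_pV2// posrE invr_gt0.
have cV0 : 0 < c^-1 by rewrite invr_gt0.
(* The affine map sends c^-1 to the threshold 1/2. Both z^-1 and c^-1 lie in [0, 4], so the slope
   1/8 keeps the values in [0, 1]. *)
pose y (z : Zspace R) := 2^-1 + 8^-1 * ((val z)^-1 - c^-1).
(* The polynomials [q n] take values in [[0, 1]] on [[0, 4]] and converge there
   pointwise to the indicator function of [[0, c^-1[]. *)
pose q n : {poly R} :=
  (1 - (2^-1%:P + 8^-1 *: ('X - c^-1%:P)) ^+ n) ^+ (n * 2 ^ n).
have qE n (z : Zspace R) : (q n).[(val z)^-1] = (1 - y z ^+ n) ^+ (n * 2 ^ n).
  by rewrite /q !hornerE.
have y01 z : 0 <= y z <= 1 by have := Zinv_itv z; rewrite /y; lra.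
have y2 z : (y z < 2^-1) = (c < val z).
  have z0 := Zset_gt0 (set_mem (valP z)).
  by rewrite -[RHS]ltf_pV2 ?posrE// /y gtrDl pmulr_rlt0 ?subr_lt0// invr_gt0.
have q1 n (z : Zspace R) : `|(q n).[(val z)^-1]| <= 1.
  have /andP[y0 y1] := y01 z.
  have yn0 : 0 <= y z ^+ n by rewrite exprn_ge0.
  have yn1 : y z ^+ n <= 1 by rewrite exprn_ile1.
  by rewrite qE normrX exprn_ile1// ger0_norm ?subr_ge0// gerBl.
set A : set (Zspace R) := val @^-1` `]c, +oo[.
have mA : measurable A.
  by apply: measurable_preimage_val; exact: measurable_itv.
have mf : measurable_fun setT f by apply/measurable_EFinP/measurable_int/intf.
have mlim : measurable_fun setT (fun z : Zspace R => ((f \_ A) z)%:E).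
  by apply/measurable_EFinP; apply/(measurable_restrictT f mA)/measurable_funTS.
have [|||_ _] := @dominated_convergence _ _ _ Zmu setT measurableT
  (fun n z => (f z * (q n).[(val z)^-1])%:E) _ (fun z => `|(f z)%:E|%E)
  (fun n => measurable_int _ (integrable_mul_poly (q n))) mlim.
- apply: aeW => z _; apply: cvg_EFin; first exact: nearW.
  rewrite [X in _ --> X](_ : _ = f z * (y z < 2^-1)%R%:R); last first.
    rewrite patchE y2 (_ : (z \in A) = (c < val z)).
      by case: ifP; rewrite ?mulr1 ?mulr0.
    by apply/idP/idP; rewrite inE /A /= in_itv/= andbT.
  apply: cvgM; first exact: cvg_cst.
  under eq_cvg do rewrite qE.
  exact: cvg_step_expr.
- exact: integrable_abse.
- apply: aeW => z n _ /=; rewrite lee_fin normrM.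
  by rewrite ler_piMr// q1.
rewrite (_ : [sequence _]_n = cst 0%E); last first.
  apply/funext => n /=.
  rewrite -[LHS]fineK; last exact: integrable_fin_num (integrable_mul_poly (q n)).
  congr EFin; exact: integral_mul_poly0.
move=> /(cvg_unique _ (cvg_cst _)) /= int0.
by rewrite Rintegral_mkcond /Rintegral -int0.
Qed.

(** Open right rays generate the Borel sets and are stable under intersection, and the sets with
    zero integral form a Dynkin system. *)
Lemma Rintegral_borel0 (A : set (measurableTypeR R)) : measurable A ->
  \int[Zmu]_(z in val @^-1` A) f z = 0.
Proof.
rewrite RGenOInfty.measurableE => mA.
apply: (@dynkin_induction _ _ (@RGenOInfty.G R)
  (fun A => \int[Zmu]_(z in val @^-1` A) f z = 0)) mA.
- exact: RGenOInfty.measurableE.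
- move=> _ _ [x ->] [y ->]; exists (Num.max x y).
  by apply/seteqP; split=> z /=; rewrite !in_itv/= !andbT gt_max => /andP.
- by rewrite preimage_setT Rintegral_setT0.
- by move=> _ [x ->]; exact: Rintegral_tail0.
- move=> S mS S0; rewrite preimage_setC.
  have mvS := measurable_preimage_val mS.
  have := @Rintegral_setU _ _ _ Zmu _ _ f mvS (measurableC mvS).
  rewrite setUCr S0 add0r Rintegral_setT0 => /(_ intf) <- //.
  by apply/disj_setPCl.
- move=> F mF tF F0; rewrite preimage_bigcup.
  have mvF n : measurable (val @^-1` F n : set (Zspace R)).
    exact: measurable_preimage_val (mF n).
  rewrite /Rintegral integral_bigcup//.
  + rewrite eseries0// => n _ _.
    have iF : Zmu.-integrable (val @^-1` F n) (EFin \o f).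
      exact: integrableS intf.
    by rewrite -[LHS]fineK ?[fine _]F0//; exact: integrable_fin_num.
  + apply/trivIsetP => i j _ _ ij; rewrite -preimage_setI.
    by move/trivIsetP : tF => ->//; rewrite preimage_set0.
  + by apply: integrableS intf => //; exact: bigcupT_measurable.
Qed.

Lemma Rintegral_Zmeasurable0 (E : set (Zspace R)) : measurable E ->
  \int[Zmu]_(z in E) f z = 0.
Proof.
move=> mE.
have : lebesgue_measurable ((val : Zspace R -> R) @` E) by exact: mE.
(* The image of [E] is a Borel set [A] together with a subset [N] of a Borel null set [N']. The
   preimage of [N'] is null for mu because [Zlaw] is dominated by Lebesgue measure. *)
rewrite /lebesgue_measurable -completed_caratheodory_measurable.
rewrite g_sigma_completed_algebra_genE => -[A mA [N [N' [mN' N'0 NN']]]] AN.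
pose EA : set (Zspace R) := val @^-1` A.
have EAE : EA `<=` E.
  move=> z Az; have : (A `|` N) (val z) by left.
  by rewrite AN => -[w Ew /val_inj <-].
have mEA : measurable EA by exact: measurable_preimage_val.
have EN : E `\` EA `<=` val @^-1` N'.
  move=> z [Ez nAz]; apply: NN'; have : (A `|` N) (val z) by rewrite AN; exists z.
  by case.
have mEEA : measurable (E `\` EA) by exact: measurableD.
have E0 : Zmu (E `\` EA) = 0%E.
  apply/eqP; rewrite eq_le measure_ge0 andbT.
  rewrite (le_trans (le_measure _ _ _ EN)) ?inE//.
    exact: measurable_preimage_val.
  have /null_content_dominatesP := @Zlaw_dominated R.
  by move=> /(_ N' mN' N'0) N'0'; rewrite -[leLHS]/(Zlaw N') N'0'.
rewrite -(setDUK EAE) Rintegral_setU//.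
- rewrite Rintegral_borel0// add0r /Rintegral null_set_integral//.
  exact/measurable_funTS/measurable_int/intf.
- by rewrite setDUK//; exact: integrableS intf.
- by apply/disj_set2P; exact: setDIK.
Qed.

Lemma orthogonal_ae_eq0 : ae_eq Zmu setT f (cst 0).
Proof.
have f0 : ae_eq Zmu setT (EFin \o f) (cst 0%E).
  apply: integral_ae_eq => // E _ mE; rewrite integral0.
  rewrite -[LHS]fineK; first by congr EFin; exact: Rintegral_Zmeasurable0.
  by apply: integrable_fin_num => //; exact: integrableS intf.
by apply: filterS f0 => z /(_ I) [].
Qed.

End orthogonal_to_polynomials.

(** * Inner products of classes in L^2 *)

Section L2_Zmu.
Variable R : realType.
Local Notation Zmu := (@Zmu R).
Local Notation L2 := (LspaceType2 Zmu).

Lemma measurable_L2 (f : L2) : measurable_fun setT (f : Zspace R -> R).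
Proof. exact: (@measurable_funPT _ _ (Zspace R) (measurableTypeR R)
  (repr (LebesgueSpace.sort f))). Qed.

Lemma L2_Lfun (f : L2) : (f : Zspace R -> R) \in Lfun Zmu 2%:E.
Proof.
rewrite inE; apply/andP; split; rewrite inE/=; first exact: measurable_L2.
by case: f => f [[]].
Qed.

Lemma g_even_Lfun n : @g_even R n \in Lfun Zmu 2%:E.
Proof.
rewrite inE; apply/andP; split; rewrite inE/=; first exact: measurable_g_even.
exact: g_even_finite_norm.
Qed.

Lemma integrable_mul_g_even (f : L2) n :
  Zmu.-integrable setT (EFin \o (fun z => f z * g_even n z)).
Proof.
by apply/Lfun1_integrable; apply: Lfun2_mul_Lfun1; [exact: L2_Lfun|exact: g_even_Lfun].
Qed.

Lemma integrable_L2 (f : L2) : Zmu.-integrable setT (EFin \o f).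
Proof.
apply/Lfun1_integrable; apply: (Lfun_subset12 _ (L2_Lfun f)).
by rewrite ge0_fin_numE ?Zmu_fin.
Qed.

(** The representative chosen for the class is only almost everywhere equal to [g_even n], which is
    enough for the integral. *)
Lemma L2_dot_g_evenr (f : L2) n :
  L2_dot f (g_even_L2 R n) = \int[Zmu]_z (f z * g_even n z).
Proof.
have : ae_eq Zmu setT (g_even_L2 R n) (g_even n) := ae_class_eq (@g_even R n).
move: (g_even_L2 R n) => g gE.
rewrite /L2_dot /Rintegral; congr fine.
apply: ae_eq_integral; first exact: measurableT.
- by apply/measurable_EFinP; apply: measurable_funM; exact: measurable_L2.
- exact: measurable_int (integrable_mul_g_even f n).
- by apply: filterS gE => z gz _; rewrite gz.
Qed.

(** The case n = m = 0, B = 0 of the product integral, as g_0 = 1. *)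
Lemma Zmu_setT : Zmu [set: Zspace R] = 1%E.
Proof.
have g0 : g_poly R 0 = 1.
  by rewrite /g_poly big_ord1/= bin0 !mulr1 scale1r.
have := @integral_g_poly_mul R 0 0 0 (leqnn 0).
rewrite g0 mulr1 addr0 eqxx/= addr0; under eq_integral do rewrite hornerC.
rewrite integral_cst// mul1e; apply=> z _.
by rewrite hornerC.
Qed.

Lemma integrable_poly_Zinv (p : {poly R}) :
  Zmu.-integrable setT (fun z => (p.[(val z)^-1])%:E).
Proof.
have [B pB] := poly_Zinv_bounded p.
apply: measurable_bounded_integrable; first exact: measurableT.
- exact: Zmu_fin.
- exact: measurable_poly_Zinv.
- exists B; split; first exact: num_real.
  by move=> M BM z _ /=; rewrite (le_trans (pB z))// ltW.
Qed.

(** Taking for [B] a bound of the product makes the shifted integrand nonnegative. As mu has total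
    mass 1, the shift contributes exactly [B], which cancels. *)
Lemma Rintegral_g_even n m :
  \int[Zmu]_z (g_even n z * g_even m z) = (n == m)%:R.
Proof.
wlog mn : n m / (m <= n)%N.
  move=> H; have [/H//|/ltnW/H] := leqP m n.
  by rewrite eq_sym => <-; apply: eq_Rintegral => z _; rewrite mulrC.
pose p := g_poly R n * g_poly R m.
have [B pB] := poly_Zinv_bounded p.
under eq_Rintegral do rewrite !g_evenE_poly -hornerM -/p.
have pge0 z : 4^-1 <= z -> 0 <= (p + B%:P).[z^-1].
  move=> z4; have Zz : z \in @Zset R by rewrite inE /Zset /= in_itv/= z4.
  have := pB (exist _ z Zz); rewrite ler_norml /= hornerD hornerC => /andP[+ _].
  by lra.
have := integral_g_poly_mul mn pge0 => /(congr1 fine) /=.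
rewrite -/p -[LHS]/(\int[Zmu]_z (p + B%:P).[(val z)^-1]).
under eq_Rintegral do rewrite hornerD hornerC.
rewrite RintegralD//; last 2 first.
- exact: integrable_poly_Zinv.
- by have := integrable_poly_Zinv B%:P; under eq_fun do rewrite hornerC.
by rewrite Rintegral_cst// [X in fine X]Zmu_setT/= mulr1 => /addIr.
Qed.

Lemma L2_dot_g_even n m :
  L2_dot (g_even_L2 R n) (g_even_L2 R m) = (n == m)%:R.
Proof.
rewrite L2_dot_g_evenr -Rintegral_g_even.
have : ae_eq Zmu setT (g_even_L2 R n) (g_even n) := ae_class_eq (@g_even R n).
move: (g_even_L2 R n) => f fg.
rewrite /Rintegral; congr fine.
apply: ae_eq_integral; first exact: measurableT.
- exact: measurable_int (integrable_mul_g_even f m).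
- by apply/measurable_EFinP; apply: measurable_funM; exact: measurable_g_even.
- by apply: filterS fg => z fz _; rewrite fz.
Qed.

Lemma L2_dot_g_even_eq0 (f : L2) :
  (forall n, L2_dot f (g_even_L2 R n) = 0) -> L2_dot f f = 0.
Proof.
move=> fg; have f0 : ae_eq Zmu setT f (cst 0).
  apply: orthogonal_ae_eq0 => [|n]; first exact: integrable_L2.
  by rewrite -L2_dot_g_evenr.
transitivity (\int[Zmu]_(z in setT) (0 : R)); last by rewrite /Rintegral integral0.
rewrite /L2_dot /Rintegral; congr fine.
apply: ae_eq_integral; first exact: measurableT.
- by apply/measurable_EFinP; apply: measurable_funM; exact: measurable_L2.
- exact: measurable_cst.
- by apply: filterS f0 => z fz _; rewrite fz//= mulr0.
Qed.

End L2_Zmu.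

Theorem theorem14 (R : realType) :
  injective (@g_even_L2 R) /\ orthonormal_basis (range (@g_even_L2 R)).
Proof.
split.
  move=> n m gnm; have := L2_dot_g_even R n m; rewrite -gnm L2_dot_g_even eqxx.
  by case: eqP => // _ /eqP; rewrite oner_eq0.
split.
  split=> [_ [n _ <-]|_ _ [n _ <-] [m _ <-] gnm]; first by rewrite L2_dot_g_even eqxx.
  by rewrite L2_dot_g_even; case: eqP gnm => // ->.
move=> S [S1 S0] gS; apply/seteqP; split=> // f Sf.
(* A member of [S] outside the family would be orthogonal to all of it, hence of norm 0, whereas
   members of [S] have norm 1. *)
apply: contrapT => gf.
have f0 : L2_dot f f = 0.
  apply: L2_dot_g_even_eq0 => n; apply: S0; [exact: Sf|by apply: gS; exists n|].
  by move=> fg; apply: gf; exists n.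
by have := S1 f Sf; rewrite f0 => /esym/eqP; rewrite oner_eq0.
Qed.
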